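(* Let $\mathcal{Q}$ be a non-principal ultrafilter on $\mathbb{N}$ and let $\{\varepsilon_n\}_{n\in\mathbb{N}}$ be a sequence of positive real numbers tending to $0$. For every nonempty bounded set $A\subset\mathbb{R}^d$ the nonstandard Minkowski dimension $\dim_{\mathcal{Q},\varepsilon_n}(A)$ exists, and if the standard Minkowski dimension $\dim_M(A)$ exists, then $\dim_{\mathcal{Q},\varepsilon_n}(A)=\dim_M(A)$.
   Context: Standard Minkowski dimension: for bounded $A\subset\mathbb{R}^d$ and $\varepsilon>0$, $N_A(\varepsilon)$ is the minimum number of (closed, axis-parallel) cubes of side length $\varepsilon$ in $\mathbb{R}^d$ needed to cover $A$. The Minkowski dimension is $\dim_M(A)=\lim_{\varepsilon\to0^+}\frac{\log N_A(\varepsilon)}{\log(1/\varepsilon)}$, if this limit exists. Dyadic covering number: for $k\in\mathbb{Z}$, the dyadic cubes of side length $2^{-k}$ in $\mathbb{R}^d$ are the sets $[m_12^{-k},(m_1+1)2^{-k})\times\cdots\times[m_d2^{-k},(m_d+1)2^{-k})$ with $m_1,\dots,m_d\in\mathbb{Z}$, and $S_A(2^{-k})$ is the minimal number of dyadic cubes of side length $2^{-k}$ needed to cover $A$. For real $\varepsilon>0$ set $S_A(\varepsilon)=S_A(2^{-k})$, where $k\in\mathbb{Z}$ is the unique integer with $2^{-(k+1)}<\varepsilon\le 2^{-k}$. Ultralimit: a non-principal ultrafilter on $\mathbb{N}$ is a proper filter $\mathcal{Q}$ such that for every $E\subset\mathbb{N}$ either $E\in\mathcal{Q}$ or $\mathbb{N}\setminus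 E\in\mathcal{Q}$, and such that no finite set belongs to $\mathcal{Q}$. For a real sequence $\{a_n\}$ (defined for all large $n$), $\lim_{\mathcal{Q}}a_n=l$ means that $l$ is the unique real number such that $\{n:a_n\in U\}\in\mathcal{Q}$ for every open interval $U$ containing $l$. Nonstandard Minkowski dimension: $\dim_{\mathcal{Q},\varepsilon_n}(A)=\lim_{\mathcal{Q}}\frac{\log S_A(\varepsilon_n)}{\log(1/\varepsilon_n)}$. *)

(* Defs.v *)
From mathcomp Require Import all_boot all_order all_algebra.
From mathcomp Require Import all_classical all_reals all_analysis.
Import Order.TTheory GRing.Theory Num.Theory.
Import numFieldNormedType.Exports.

Set Implicit Arguments.
Unset Strict Implicit.
Unset Printing Implicit Defensive.

Local Open Scope classical_set_scope.
Local Open Scope ring_scope.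

(* Junk value 0 when P holds of no natural number. *)
Definition least_nat (P : nat -> Prop) : nat :=
  xget 0%N [set n | P n /\ forall m, P m -> (n <= m)%N].

Definition closed_cube (R : realType) (d : nat) (eps : R) (c : 'rV[R]_d) :
    set 'rV[R]_d :=
  [set x | forall i, c 0 i <= x 0 i <= c 0 i + eps].

Definition dyadic_cube (R : realType) (d : nat) (k : int) (m : 'rV[int]_d) :
    set 'rV[R]_d :=
  [set x | forall i,
     (m 0 i)%:~R * 2 ^ (- k) <= x 0 i < (m 0 i + 1)%:~R * 2 ^ (- k)].

(* The cubes of a cover are indexed by 'I_n and may repeat; this does not
   affect the minimum. *)
Definition covering_number (R : realType) (d : nat) (A : set 'rV[R]_d)
    (eps : R) : nat :=
  least_nat (fun n => exists c : 'I_n -> 'rV[R]_d,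
    A `<=` \bigcup_(j in [set: 'I_n]) closed_cube eps (c j)).

Definition dyadic_covering_number_at (R : realType) (d : nat)
    (A : set 'rV[R]_d) (k : int) : nat :=
  least_nat (fun n => exists c : 'I_n -> 'rV[int]_d,
    A `<=` \bigcup_(j in [set: 'I_n]) @dyadic_cube R d k (c j)).

(* For eps > 0 there is exactly one such k, so the default is never used. *)
Definition dyadic_scale (R : realType) (eps : R) : int :=
  xget 0 [set k : int | (2 : R) ^ (- (k + 1)) < eps <= (2 : R) ^ (- k)].

Definition dyadic_covering_number (R : realType) (d : nat)
    (A : set 'rV[R]_d) (eps : R) : nat :=
  dyadic_covering_number_at A (dyadic_scale eps).

Definition is_minkowski_dim (R : realType) (d : nat) (A : set 'rV[R]_d)
    (s : R) : Prop :=
  ln (covering_number A eps)%:R / ln (1 / eps) @[eps --> (0 : R)^'+] --> s.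

Definition nonprincipal_ultrafilter (Q : set_system nat) : Prop :=
  [/\ ProperFilter Q,
      forall E : set nat, Q E \/ Q (~` E) &
      forall E : set nat, finite_set E -> ~ Q E].

Definition is_ultralimit (R : realType) (Q : set_system nat) (a : nat -> R)
    (l : R) : Prop :=
  unique (fun x : R => forall U : set R,
    open U -> is_interval U -> U x -> Q [set n | U (a n)]) l.

(* When eps tends to 0 only finitely many terms can have ln (1 / eps n) = 0,
   so the convention x / 0 = 0 does not affect the ultralimit. *)
Definition is_nonstandard_minkowski_dim (R : realType) (d : nat)
    (Q : set_system nat) (eps : nat -> R) (A : set 'rV[R]_d) (s : R) : Prop :=
  is_ultralimit Q
    (fun n => ln (dyadic_covering_number A (eps n))%:R / ln (1 / eps n)) s.

(* Main.v *)
(* A closed cube of side e meets at most 2^d dyadic cubes of the scale 2^-k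
   attached to e, since e <= 2^-k, and a dyadic cube of that scale is covered
   by 2^d closed cubes of side e, since 2^-k < 2 e. Hence ln S and ln N differ
   by at most d ln 2, so the difference of the two ratios tends to 0 along eps.
   Since moreover S is at most (C / e)^d, the ratio for S is eventually bounded,
   and a bounded sequence has an ultralimit by compactness of segments. *)
Require Import Defs.
From mathcomp Require Import all_boot all_order all_algebra.
From mathcomp Require Import all_classical all_reals all_analysis.
From mathcomp Require Import lra.
Import Order.TTheory GRing.Theory Num.Theory.
Import numFieldNormedType.Exports.

Set Implicit Arguments.
Unset Strict Implicit.
Unset Printing Implicit Defensive.

Local Open Scope classical_set_scope.
Local Open Scope ring_scope.

Lemma least_natP (P : nat -> Prop) (n : nat) : P n ->
  P (least_nat P) /\ forall m, P m -> (least_nat P <= m)%N.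
Proof.
move=> Pn; apply: (@xgetPex _ 0%N [set n | P n /\ forall m, P m -> (n <= m)%N]).
have ePb : exists n, `[< P n >] by exists n; apply/asboolP.
exists (ex_minn ePb); case: ex_minnP => m /asboolP Pm mmin; split => // p Pp.
by apply: mmin; apply/asboolP.
Qed.

(** * Finite covers and their refinement *)

Section Covers.
Context {X : Type}.

(** For closed or dyadic cubes as [F], this is convertible to the predicate minimised in the
    corresponding covering number, so [least_natP] applies to it. *)
Definition coverable {T : Type} (F : T -> set X) (A : set X) (n : nat) : Prop :=
  exists c : 'I_n -> T, A `<=` \bigcup_(j in [set: 'I_n]) F (c j).

Lemma coverable_fin {T : Type} (F : T -> set X) (A : set X) (I : finType)
    (c : I -> T) :
  A `<=` \bigcup_(i in [set: I]) F (c i) -> coverable F A #|I|.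
Proof.
move=> Ac; exists (fun j => c (enum_val j)) => x /Ac [i _ Fx].
by exists (enum_rank i) => //; rewrite enum_rankK.
Qed.

Lemma coverable_refine {T T' : Type} (F : T -> set X) (G : T' -> set X)
    (J : finType) (A : set X) (n : nat) :
  (forall t, exists c : J -> T', F t `<=` \bigcup_(j in [set: J]) G (c j)) ->
  coverable F A n -> coverable G A (n * #|J|).
Proof.
move=> /choice[r FG] [c Ac].
have -> : (n * #|J| = #|{: 'I_n * J}|)%N by rewrite card_prod card_ord.
apply: (@coverable_fin _ _ _ _ (fun p => r (c p.1) p.2)).
move=> x /Ac [i _ /FG[j _ Gx]].
by exists (i, j).
Qed.

Lemma coverable_gt0 {T : Type} (F : T -> set X) (A : set X) (n : nat) :
  A !=set0 -> coverable F A n -> (0 < n)%N.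
Proof. by case=> x Ax [c /(_ x Ax)[[i ilt] _ _]]; apply: leq_ltn_trans ilt. Qed.

End Covers.

(** * Dyadic cubes against closed cubes, and the size of covering numbers *)

Section Dyadic.
Context {R : realType}.
Implicit Types (e : R) (k : int).

Lemma exprz2E k : (2 : R) ^ k = expR (k%:~R * ln 2).
Proof. by rewrite -powR_intmul ?ler0n// /powR pnatr_eq0. Qed.

Lemma dyadic_scaleP e : 0 < e ->
  (2 : R) ^ (- (dyadic_scale e + 1)) < e <= (2 : R) ^ (- dyadic_scale e).
Proof.
move=> e0; apply: (@xgetPex _ 0
  [set k : int | (2 : R) ^ (- (k + 1)) < e <= (2 : R) ^ (- k)]).
have l2 : 0 < ln (2 : R) by rewrite ln_gt0// ltr1n.
have /andP[fl fu] := floor_itv (- (ln e / ln 2)).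
(* The scale is the integer part of log_2 (1/e); the strict upper bound of the floor becomes the
   strict lower bound on [e]. *)
exists (Num.floor (- (ln e / ln 2))).
have eE : expR (ln e) = e by rewrite lnK ?posrE.
rewrite /= !exprz2E; apply/andP; split.
  rewrite -[ltRHS]eE ltr_expR mulrNz mulNr ltrNl -ltr_pdivrMr//.
  by rewrite mulNr.
by rewrite -[leLHS]eE ler_expR mulrNz mulNr lerNr -ler_pdivlMr// mulNr.
Qed.

Context {d : nat}.
Implicit Types A : set 'rV[R]_d.

(** In each coordinate a segment no longer than 2^-k meets only the dyadic interval of its left end
    and the next one; the bit [b i] chooses between them. *)
Lemma closed_cube_sub_dyadic e k (c : 'rV[R]_d) : e <= 2 ^ (- k) ->
  exists m : {ffun 'I_d -> bool} -> 'rV[int]_d,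
    closed_cube e c `<=`
      \bigcup_(b in [set: {ffun 'I_d -> bool}]) dyadic_cube k (m b).
Proof.
set s := 2 ^ (- k) => es; have s0 : 0 < s by rewrite exprz_gt0.
exists (fun b => \row_i (Num.floor (c 0 i / s) + Posz (nat_of_bool (b i)))).
move=> x cx.
exists [ffun i => (Num.floor (c 0 i / s) + 1)%:~R * s <= x 0 i] => // i.
rewrite !mxE ffunE -/s; have /andP[cx1 cx2] := cx i.
have := floor_itv (c 0 i / s); set f := Num.floor _.
rewrite ler_pdivlMr// ltr_pdivrMr// !intrD => /andP[fl fu].
by case: (leP ((f%:~R + 1%:~R) * s) (x 0 i)) => xs;
  rewrite ?mulr1z ?mulr0z in fu xs *; apply/andP; split; lra.
Qed.

(** Two adjacent segments of length [e] cover each side of the dyadic cube; the bit [b i] tells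
    which one is used in coordinate [i]. *)
Lemma dyadic_cube_sub_closed e k (m : 'rV[int]_d) : (2 : R) ^ (- k) <= 2 * e ->
  exists c : {ffun 'I_d -> bool} -> 'rV[R]_d,
    dyadic_cube k m `<=`
      \bigcup_(b in [set: {ffun 'I_d -> bool}]) closed_cube e (c b).
Proof.
set s := 2 ^ (- k) => es.
exists (fun b => \row_i ((m 0 i)%:~R * s + (nat_of_bool (b i))%:R * e)) => x mx.
exists [ffun i => (m 0 i)%:~R * s + e <= x 0 i] => // i.
rewrite !mxE ffunE; have /andP[] := mx i; rewrite -/s intrD mulr1z => mx1 mx2.
case: (leP ((m 0 i)%:~R * s + e) (x 0 i)) => xs;
  rewrite ?mul0r ?mul1r; apply/andP; split; lra.
Qed.

Lemma dyadic_coverable_bounded A (M : nat) k :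
  (forall x, A x -> forall i, `|x 0 i| <= M%:R) ->
  coverable (@dyadic_cube R d k) A
    ((Num.truncn (2 * M%:R / (2 : R) ^ (- k))).+2 ^ d)%N.
Proof.
set s := 2 ^ (- k) => AM; have s0 : 0 < s by rewrite exprz_gt0.
set L := (Num.truncn _).+2.
have -> : (L ^ d = #|{: {ffun 'I_d -> 'I_L}}|)%N by rewrite card_ffun !card_ord.
set f := Num.floor (- M%:R / s).
apply: (@coverable_fin _ _ _ _ _
  (fun b : {ffun 'I_d -> 'I_L} => \row_i (f + (b i : nat)%:Z))).
move=> x /AM xM.
exists [ffun i : 'I_d => inord `|Num.floor (x ord0 i / s) - f|%N] => // i.
rewrite !mxE ffunE -/s.
have := xM i; rewrite ler_norml => /andP[x1 x2].
have f1 : f <= Num.floor (x 0 i / s).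
  by apply: le_floor; rewrite ler_pM2r ?invr_gt0.
set g := Num.floor _ in f1 *.
have fE : Posz (absz (g - f)) = g - f.
  by rewrite gez0_abs// subr_ge0.
(* The index is below [L], so [inord] does not fall back on its default: g <= M/s and f > -M/s - 1
   give g - f < 2M/s + 1, and truncating 2M/s costs less than one more. *)
rewrite inordK; last first.
  rewrite -(ltr_nat R) -[X in X < _]/((Posz _)%:~R) fE intrB.
  have fu := floor_le (x 0 i / s).
  have /andP[_] := floor_itv (- M%:R / s).
  rewrite -/f intrD => fl.
  have tg := truncnS_gt (2 * M%:R / s).
  have xs : x 0 i / s <= M%:R / s by rewrite ler_pM2r ?invr_gt0.
  rewrite /L [_.+2%:R]mulrSr; lra.
rewrite fE subrKC -ler_pdivlMr// -ltr_pdivrMr//.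
exact: floor_itv.
Qed.

Lemma bounded_setP A : bounded_set A ->
  exists M : nat, forall x, A x -> forall i, `|x 0 i| <= M%:R.
Proof.
move=> [M [_ AM]]; exists (Num.truncn M).+1 => x Ax i.
apply: le_trans (AM _ (truncnS_gt M) x Ax).
rewrite [leRHS]mx_normrE.
exact: (le_bigmax _ (fun ij => `|x ij.1 ij.2|) (0, i)).
Qed.

Lemma dyadic_coverable_closed A e n : 0 < e ->
  coverable (dyadic_cube (dyadic_scale e)) A n ->
  coverable (closed_cube e) A (n * 2 ^ d)%N.
Proof.
move=> e0 An; have /andP[ke _] := dyadic_scaleP e0.
have := @coverable_refine _ _ _ _ (closed_cube e)
  {ffun 'I_d -> bool} _ _ _ An.
rewrite card_ffun card_bool card_ord; apply => m; apply: dyadic_cube_sub_closed.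
move: ke; rewrite opprD expfzDr ?pnatr_eq0// exprN1.
by rewrite ltr_pdivrMr// mulrC => /ltW.
Qed.

Lemma closed_coverable_dyadic A e n : 0 < e ->
  coverable (closed_cube e) A n ->
  coverable (dyadic_cube (dyadic_scale e)) A (n * 2 ^ d)%N.
Proof.
move=> e0 An; have /andP[_ ke] := dyadic_scaleP e0.
have := @coverable_refine _ _ _ _ (@dyadic_cube R d (dyadic_scale e))
  {ffun 'I_d -> bool} _ _ _ An.
by rewrite card_ffun card_bool card_ord; apply => m;
  apply: closed_cube_sub_dyadic.
Qed.

(** Boundedness provides finite covers of both kinds, so neither number is the junk value of
    [least_nat]; nonemptiness makes both positive, so their logarithms are meaningful. *)
Lemma covering_numbers_comparable A e : A !=set0 -> bounded_set A -> 0 < e ->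
  [/\ (0 < dyadic_covering_number A e)%N, (0 < covering_number A e)%N,
      (dyadic_covering_number A e <= covering_number A e * 2 ^ d)%N &
      (covering_number A e <= dyadic_covering_number A e * 2 ^ d)%N].
Proof.
move=> A0 /bounded_setP[M AM] e0.
have [Sc Smin] := least_natP (dyadic_coverable_bounded (dyadic_scale e) AM).
have [Nc Nmin] := least_natP (dyadic_coverable_closed e0 Sc).
split; [exact: coverable_gt0 A0 Sc|exact: coverable_gt0 A0 Nc| |].
  exact: Smin (closed_coverable_dyadic e0 Nc).
exact: Nmin (dyadic_coverable_closed e0 Sc).
Qed.

Lemma ler_ln_nat (m n : nat) : (0 < m)%N -> (m <= n)%N ->
  ln (m%:R : R) <= ln n%:R.
Proof.
move=> m0 mn; rewrite ler_ln ?posrE ?ltr0n ?ler_nat//.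
exact: leq_trans mn.
Qed.

Lemma ln_natM_exp (m : nat) : (0 < m)%N ->
  ln ((m * 2 ^ d)%:R : R) = ln m%:R + d%:R * ln 2.
Proof.
move=> m0; rewrite natrM natrX lnM ?posrE ?ltr0n ?exprn_gt0//.
by rewrite lnXn// mulr_natl.
Qed.

Lemma ln_covering_numbers_dist A e : A !=set0 -> bounded_set A -> 0 < e ->
  `|ln (dyadic_covering_number A e)%:R - ln (covering_number A e)%:R|
    <= d%:R * ln (2 : R).
Proof.
move=> A0 Ab e0; have [S0 N0 SN NS] := covering_numbers_comparable A0 Ab e0.
have := ler_ln_nat S0 SN; have := ler_ln_nat N0 NS.
rewrite !ln_natM_exp// => h1 h2.
by rewrite ler_norml; apply/andP; split; lra.
Qed.

Lemma ln_dyadic_covering_number_le A (M : nat) e : A !=set0 ->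
  (forall x, A x -> forall i, `|x 0 i| <= M%:R) -> 0 < e <= 1 / 2 ->
  ln (dyadic_covering_number A e)%:R <= d%:R * (ln (2 * M%:R + 2) + ln (1 / e)).
Proof.
move=> A0 AM /andP[e0 e2]; have /andP[ke ek] := dyadic_scaleP e0.
have AL := dyadic_coverable_bounded (dyadic_scale e) AM.
have [Sc /(_ _ AL) SL] := least_natP AL.
apply: le_trans (ler_ln_nat (coverable_gt0 A0 Sc) SL) _.
set s := 2 ^ (- _) in ek SL *.
have s0 : 0 < s by rewrite exprz_gt0.
(* s/2 < e <= 1/2. This allows 2M/s + 2 <= (2M + 2)/s, and then e <= s replaces [s] by [e]. *)
have s1 : s <= 1.
  move: ke; rewrite opprD expfzDr ?pnatr_eq0// exprN1 -/s; lra.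
rewrite natrX lnXn// -[ln _ *+ _]mulr_natl; apply: ler_wpM2l => //.
have M0 : 0 < 2 * M%:R + 2 :> R by rewrite ltr_wpDl// mulr_ge0.
rewrite div1r -lnM ?posrE ?invr_gt0//
  ler_ln ?posrE ?ltr0n ?mulr_gt0 ?invr_gt0//.
apply: (@le_trans _ _ (2 * M%:R / s + 2)).
  rewrite -addn2 natrD lerD2r truncn_le divr_ge0// ?mulr_ge0//; exact: ltW.
apply: (@le_trans _ _ ((2 * M%:R + 2) / s)).
  by rewrite [leRHS]mulrDl lerD2l ler_pdivlMr// ler_piMr.
by rewrite ler_pM2l// lef_pV2 ?posrE.
Qed.

End Dyadic.

(** * Ultralimits of real sequences *)

Section Ultralimit.
Context {R : realType} {Q : set_system nat}.
Context (HQ : nonprincipal_ultrafilter Q).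
Implicit Types a : nat -> R.

Lemma nonprincipal_near (P : set nat) : (\forall n \near \oo, P n) -> Q P.
Proof.
case: HQ => _ Qor Qfin [N _ NP]; case: (Qor P) => // QP.
case: (Qfin _ _ QP); apply: (sub_finite_set _ (finite_II N)) => n /= nP.
by rewrite ltnNge; apply/negP => /NP.
Qed.

(** Uniqueness is automatic: the open half-lines on either side of the midpoint of two distinct
    limits would have disjoint preimages, both in [Q]. *)
Lemma is_ultralimitP a l :
  (forall U : set R, open U -> is_interval U -> U l -> Q [set n | U (a n)]) ->
  is_ultralimit Q a l.
Proof.
case: HQ => QF _ _.
suff lt_false x y : x < y ->
    (forall U : set R, open U -> is_interval U -> U x -> Q [set n | U (a n)]) ->
    (forall U : set R, open U -> is_interval U -> U y -> Q [set n | U (a n)]) ->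
    False.
  move=> lP; split=> // x xP.
  by case: (ltgtP l x) => // /lt_false; [move/(_ lP xP)|move/(_ xP lP)].
move=> xy xP yP.
pose m := (x + y) / 2; have [xm my] := midf_lt xy.
have Qx : Q [set n | a n < m].
  apply: (xP [set z | z < m]) => // u v _ vm z /andP[_ zv].
  exact: le_lt_trans vm.
have Qy : Q [set n | m < a n].
  apply: (yP [set z | m < z]) => // u v mu _ z /andP[uz _].
  exact: lt_le_trans uz.
have [n [/= an na]] := filter_ex (filterI Qx Qy).
by have := lt_trans an na; rewrite ltxx.
Qed.

Lemma cvg_is_ultralimit a l : a n @[n --> \oo] --> l -> is_ultralimit Q a l.
Proof.
move=> al; apply: is_ultralimitP => U oU _ Ul.
by apply: nonprincipal_near; apply: al; apply: open_nbhs_nbhs.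
Qed.

Lemma bounded_ultralimit a (lo hi : R) :
  (\forall n \near \oo, lo <= a n <= hi) -> exists l, is_ultralimit Q a l.
Proof.
case: (HQ) => QF Qor _ /nonprincipal_near Qlohi.
have Qab : Q (a @^-1` `[lo, hi]%classic).
  by apply: filterS Qlohi => n; rewrite /= in_itv/=.
have [l [_ lcl]] := segment_compact (fmap_proper_filter a QF) Qab.
exists l; apply: is_ultralimitP => U oU _ Ul.
(* A cluster point of the image ultrafilter is a limit: otherwise the complement of [U] would belong
   to the image filter, yet it has to meet the neighbourhood [U] of [l]. *)
case: (Qor [set n | U (a n)]) => // QnU.
by have [x []] := lcl (~` U) U QnU (open_nbhs_nbhs (conj oU Ul)).
Qed.

End Ultralimit.

(** * The ratios along the sequence, and the conclusion *)

Lemma near_ln_inv_gt {R : realType} (eps : nat -> R) (K : R) :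
  (forall n, 0 < eps n) -> eps n @[n --> \oo] --> (0 : R) ->
  \forall n \near \oo, K < ln (1 / eps n).
Proof.
move=> eps0 epsc.
have : \forall n \near \oo, eps n < expR (- K)
  by exact: cvgr_lt epsc _ (expR_gt0 _).
apply: filterS => n; rewrite div1r lnV ?posrE// ltrNr => en.
by rewrite -ltr_expR lnK ?posrE.
Qed.

Theorem mainTheorem2 (R : realType) (d : nat) (Q : set_system nat)
    (eps : nat -> R)
    (HQ : nonprincipal_ultrafilter Q)
    (eps_gt0 : forall n : nat, 0 < eps n)
    (eps_cvg : eps n @[n --> \oo] --> (0 : R))
    (A : set 'rV[R]_d) (A_neq0 : A !=set0) (A_bounded : bounded_set A) :
  exists l : R,
    is_nonstandard_minkowski_dim Q eps A l /\
    (forall s : R, is_minkowski_dim A s -> l = s).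
Proof.
have ln_gt := near_ln_inv_gt _ eps_gt0 eps_cvg.
have [M AM] := bounded_setP A_bounded.
have [l lP] : exists l, is_nonstandard_minkowski_dim Q eps A l.
  (* With t = ln (1 / eps n) > 1, dividing ln S <= d (ln (2M + 2) + t) by t gives the value of
     [hi]. *)
  apply: (bounded_ultralimit HQ (lo := 0)
    (hi := d%:R * (ln (2 * M%:R + 2) + 1))).
  have e2 : \forall n \near \oo, eps n < 1 / 2.
    by apply: cvgr_lt eps_cvg _ _; rewrite divr_gt0.
  have := ln_gt 1; apply: filterS2 e2 => n e2 ln1.
  have ln0 := lt_trans ltr01 ln1.
  have [S0 _ _ _] := covering_numbers_comparable A_neq0 A_bounded (eps_gt0 n).
  apply/andP; split.
    by apply: divr_ge0; [rewrite ln_ge0 ?ler1n|exact: ltW].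
  have := @ln_dyadic_covering_number_le _ _ A M (eps n) A_neq0 AM.
  rewrite eps_gt0 ltW// => /(_ isT) lnS.
  rewrite ler_pdivrMr//; apply: le_trans lnS _.
  rewrite -mulrA; apply: ler_wpM2l => //.
  rewrite [leRHS]mulrDl [1 * ln _]mul1r lerD2r ler_peMr ?ltW//.
  have M0 : 0 <= M%:R :> R by [].
  by rewrite ln_gt0//; lra.
exists l; split => // s sP.
(* By uniqueness of the ultralimit, it is enough that [s] is one too. *)
suff : is_nonstandard_minkowski_dim Q eps A s by case: lP => lP lu [/lu].
apply: (cvg_is_ultralimit HQ).
have Ns := (cvg_at_rightP _ _ _).1 sP eps (conj eps_gt0 eps_cvg).
pose ratioS n := ln (dyadic_covering_number A (eps n))%:R / ln (1 / eps n) : R.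
pose ratioN n := ln (covering_number A (eps n))%:R / ln (1 / eps n) : R.
suff err0 : ratioS n - ratioN n @[n --> \oo] --> (0 : R).
  change (ratioS n @[n --> \oo] --> s).
  have -> : ratioS = (fun n => ratioN n + (ratioS n - ratioN n)).
    by apply/funext => n; rewrite subrKC.
  by rewrite -[s]addr0; apply: cvgD.
apply/cvgr0Pnorm_lt => r r0.
(* The bound 0 makes the denominator positive; the other one makes d ln 2 / ln (1 / eps n), which
   dominates the error, smaller than [r]. *)
have := ln_gt (Num.max 0 (d%:R * ln 2 / r)); apply: filterS => n.
rewrite gt_max => /andP[ln0 lnr].
rewrite -mulrBl normrM normfV (gtr0_norm ln0) ltr_pdivrMr//.
apply: le_lt_trans (ln_covering_numbers_dist A_neq0 A_bounded (eps_gt0 n)) _.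
by rewrite [ltRHS]mulrC -ltr_pdivrMr.
Qed.
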